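(* Let $\lambda\in\mathbb{R}$ and let $p$ be a positive integer. Then for all real $x$, \[ \sum_{n=1}^{\infty}\Big((1)_{p,\lambda}+(2)_{p,\lambda}+\cdots+(n)_{p,\lambda}\Big)\frac{x^n}{n!}=e^{x}\sum_{k=0}^{p}\Big(x^k+\frac{x^{k+1}}{k+1}\Big)S_{2,\lambda}(p,k). \]
   Context: For $\lambda\in\mathbb{R}$, the generalized falling factorials are $(x)_{0,\lambda}=1$ and $(x)_{n,\lambda}=x(x-\lambda)(x-2\lambda)\cdots(x-(n-1)\lambda)$ for $n\ge 1$; $(x)_0=1$ and $(x)_n=x(x-1)\cdots(x-n+1)$ denote the ordinary falling factorials. The degenerate Stirling numbers of the second kind $S_{2,\lambda}(n,k)$ ($0\le k\le n$) are defined by $(x)_{n,\lambda}=\sum_{k=0}^{n}S_{2,\lambda}(n,k)(x)_k$ for all $n\ge0$. *)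

(* Defs.v *)
From HB Require Import structures.
From mathcomp Require Import all_boot all_order all_algebra.
From mathcomp Require Import all_classical all_reals all_analysis.
From mathcomp Require Import ring.

Set Implicit Arguments.
Unset Strict Implicit.
Unset Printing Implicit Defensive.

Import Order.TTheory GRing.Theory Num.Theory.
Import numFieldNormedType.Exports.

Local Open Scope ring_scope.

Definition gen_falling (R : realType) (lambda x : R) (n : nat) : R :=
  \prod_(i < n) (x - i%:R * lambda).

Definition falling (R : realType) (x : R) (n : nat) : R :=
  \prod_(i < n) (x - i%:R).

(* The degenerate Stirling numbers are determined by their defining expansion.
   The values S n k with n < k are left free; [deg_stirling2_exists] and
   [deg_stirling2_unique] give existence, and uniqueness for k <= n. *)
Definition is_deg_stirling2 (R : realType) (lambda : R) (S : nat -> nat -> R) :=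
  forall (n : nat) (x : R),
    gen_falling lambda x n = \sum_(0 <= k < n.+1) S n k * falling x k.

Lemma deg_stirling2_exists (R : realType) (lambda : R) :
  exists S : nat -> nat -> R, is_deg_stirling2 lambda S.
Proof.
suff H n : exists s : nat -> R, forall x,
    gen_falling lambda x n = \sum_(0 <= k < n.+1) s k * falling x k.
  by have [S HS] := choice H; exists S.
elim: n => [|n [s IH]].
  exists (fun=> 1) => x.
  by rewrite /gen_falling big_nat1 /falling !big_ord0 mulr1.
exists (fun k => (if k is j.+1 then s j else 0) +
   (if (k <= n)%N then (k%:R - n%:R * lambda) * s k else 0)) => x.
rewrite /gen_falling big_ord_recr /= -/(gen_falling _ _ _) IH.
under [RHS]eq_bigr do rewrite mulrDl.
rewrite [RHS]big_split /= [X in _ = X + _]big_nat_recl //= mul0r add0r.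
rewrite [X in _ = _ + X]big_nat_recr //= ltnn mul0r addr0 -big_split /= mulr_suml.
apply: eq_big_nat => k /andP[_ kn]; rewrite -ltnS kn.
rewrite /falling big_ord_recr /=; ring.
Qed.

Lemma deg_stirling2_unique (R : realType) (lambda : R) (S T : nat -> nat -> R) :
  is_deg_stirling2 lambda S -> is_deg_stirling2 lambda T ->
  forall n k : nat, (k <= n)%N -> S n k = T n k.
Proof.
move=> HS HT n; elim/ltn_ind => k IH kn.
have := HS n k%:R; rewrite HT.
have kn' : (k < n.+1)%N by [].
have big0 (U : nat -> nat -> R) :
    \sum_(k.+1 <= j < n.+1) U n j * falling (k%:R : R) j = 0.
  rewrite big_nat big1 // => j /andP[kj _].
  by rewrite /falling (bigD1 (Ordinal kj)) //= subrr mul0r mulr0.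
rewrite !(big_cat_nat (leq0n k.+1) kn') /= !big0 !addr0 !big_nat_recr //=.
rewrite (eq_big_nat _ _ (F2 := fun j => S n j * falling (k%:R : R) j)); last first.
  by move=> j /andP[_ jk]; rewrite IH // (leq_trans (ltnW jk)).
move/addrI/mulIf => -> //.
apply/prodf_neq0 => i _.
by rewrite subr_eq0 eqr_nat gtn_eqF.
Qed.

(* Main.v *)
Require Import Defs.
From HB Require Import structures.
From mathcomp Require Import all_boot all_order all_algebra.
From mathcomp Require Import all_classical all_reals all_analysis.
From mathcomp Require Import ring.

Import Order.TTheory GRing.Theory Num.Theory.
Import numFieldNormedType.Exports.

Local Open Scope classical_set_scope.
Local Open Scope ring_scope.

(** Expand [(m)_{p,lambda}] in ordinary falling factorials. By telescoping,
    [(0)_k + ... + (n)_k = (n+1)_{k+1} / (k+1) = (n)_k + (n)_{k+1} / (k+1)],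
    and the exponential generating function of [(n)_k] is [x^k e^x], because
    [(n+1)_{k+1} / (n+1)! = (n)_k / n!]. *)

Lemma falling0 (R : realType) (x : R) : falling x 0 = 1.
Proof. by rewrite /falling big_ord0. Qed.

Lemma fallingSr (R : realType) (x : R) k :
  falling x k.+1 = falling x k * (x - k%:R).
Proof. by rewrite /falling big_ord_recr. Qed.

(** Peeling off the first factor, where [fallingSr] takes the last, leaves the factors
    [(x + 1) - (i + 1) = x - i]. This form cancels the [n + 1] in [(n + 1)!]. *)
Lemma fallingSl (R : realType) (x : R) k :
  falling (x + 1) k.+1 = (x + 1) * falling x k.
Proof.
rewrite /falling big_ord_recl subr0; congr (_ * _).
by apply: eq_bigr => i _; rewrite lift0 -natr1; ring.
Qed.

(** Lets the inner sum start at [m = 0], as in [sum_falling]; for [p = 0] the value would be [1]. *)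
Lemma gen_falling0 (R : realType) (lambda : R) p :
  (0 < p)%N -> gen_falling lambda 0 p = 0.
Proof.
by case: p => // p _; rewrite /gen_falling big_ord_recl /= mul0r subrr mul0r.
Qed.

Lemma sum_falling (R : realType) k n :
  \sum_(0 <= m < n.+1) falling (m%:R : R) k =
  falling n%:R k + falling n%:R k.+1 / k.+1%:R.
Proof.
have k0 : k%:R + 1 != 0 :> R by rewrite natr1 pnatr_eq0.
elim: n => [|n IH].
  rewrite big_nat1 -[LHS]addr0; congr (_ + _).
  by rewrite /falling big_ord_recl subrr !mul0r.
rewrite big_nat_recr //= IH addrC; congr (_ + _).
(* Factoring out [falling n%:R k] leaves [(k + 1) + (n - k) = n + 1]. *)
by rewrite -[n.+1%:R]natr1 fallingSl fallingSr -[k.+1%:R]natr1; field.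
Qed.

Lemma cvg_falling_egf (R : realType) (x : R) k :
  \sum_(0 <= n < N) falling n%:R k * (x ^+ n / n`!%:R) @[N --> \oo] -->
  expR x * x ^+ k.
Proof.
elim: k => [|k IH].
  rewrite mulr1 (_ : (fun N => _) = series (exp_coeff x)).
    exact: is_cvg_series_exp_coeff.
  by apply/funext => N; apply: eq_bigr => n _; rewrite falling0 mul1r.
(* The partial sum with [N + 1] terms for [k + 1] is exactly [x] times the one with [N] terms for
   [k]. *)
rewrite -(cvg_shiftS (fun N => \sum_(0 <= n < N) _)) /= exprS mulrCA.
rewrite (_ : (fun N => _) = fun N =>
  x * \sum_(0 <= n < N) falling n%:R k * (x ^+ n / n`!%:R)).
  by apply: cvgM => //; apply: cvg_cst.
apply/funext => N.
(* The term [n = 0] vanishes: its falling factorial has the factor [0]. *)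
rewrite big_nat_recl // {1}/falling big_ord_recl subrr !mul0r add0r mulr_sumr.
apply: eq_bigr => n _.
have n0 : n%:R + 1 != 0 :> R by rewrite natr1 pnatr_eq0.
have f0 : n`!%:R != 0 :> R by rewrite pnatr_eq0 -lt0n fact_gt0.
by rewrite factS natrM exprS -[n.+1%:R]natr1 fallingSl; field; rewrite f0 n0.
Qed.

Theorem theorem6 (R : realType) (lambda : R) (S : nat -> nat -> R)
    (hS : is_deg_stirling2 lambda S) (p : nat) (hp : (0 < p)%N) (x : R) :
  \sum_(1 <= n < N.+1)
     (\sum_(1 <= m < n.+1) gen_falling lambda m%:R p) * (x ^+ n / n`!%:R)
    @[N --> \oo] -->
  expR x * \sum_(0 <= k < p.+1) (x ^+ k + x ^+ k.+1 / k.+1%:R) * S p k.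
Proof.
have inner n : \sum_(1 <= m < n.+1) gen_falling lambda m%:R p =
    \sum_(0 <= k < p.+1)
      S p k * (falling n%:R k + falling n%:R k.+1 / k.+1%:R).
  transitivity (\sum_(0 <= m < n.+1) gen_falling lambda m%:R p).
    by rewrite [RHS]big_ltn // gen_falling0 // add0r.
  under eq_bigr do rewrite hS.
  rewrite exchange_big; apply: eq_bigr => k _.
  by rewrite -sum_falling mulr_sumr.
pose egf k N : R := \sum_(0 <= n < N) falling n%:R k * (x ^+ n / n`!%:R).
(* Exchanging the finite sums gives a combination of [p + 1] terms whose coefficients do not depend
   on [N], so the limit can be taken term by term. *)
rewrite (_ : (fun N => _) = fun N => \sum_(0 <= k < p.+1)
    S p k * (egf k N.+1 + egf k.+1 N.+1 / k.+1%:R)); last first.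
  apply/funext => N.
  (* At [n = 0] the inner sum is empty, so the outer sum may start there. *)
  transitivity (\sum_(0 <= n < N.+1)
      (\sum_(1 <= m < n.+1) gen_falling lambda m%:R p) * (x ^+ n / n`!%:R)).
    by rewrite [RHS]big_ltn // [X in _ = X * _ + _]big_geq // mul0r add0r.
  under eq_bigr do rewrite inner mulr_suml.
  rewrite exchange_big; apply: eq_bigr => k _.
  rewrite /egf mulr_suml -big_split mulr_sumr.
  by apply: eq_bigr => n _ /=; ring.
rewrite mulr_sumr; apply: cvg_big => [|k _]; first exact: add_continuous.
rewrite (_ : expR x * _ =
  S p k * (expR x * x ^+ k + expR x * x ^+ k.+1 / k.+1%:R)); last by ring.
have egfS j : egf j N.+1 @[N --> \oo] --> expR x * x ^+ j.
  by rewrite (cvg_shiftS (egf j)); apply: cvg_falling_egf.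
apply: cvgM; first exact: cvg_cst.
by apply: cvgD => //; apply: cvgM => //; apply: cvg_cst.
Qed.
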